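(* If a function $f:\mathbb{N}\to\mathbb{R}$ has an a.p.p.s. expansion in powers of $1/n$, then that expansion is unique; that is, if $f(n)\overset{*}{\sim}\sum_{r\ge0}c_r(n)/n^r$ and $f(n)\overset{*}{\sim}\sum_{r\ge0}c'_r(n)/n^r$, then $c_r=c'_r$ for every $r\ge0$.
   Context: $\mathbb{N}=\{1,2,\dots\}$. A function $\omega:\mathbb{R}\to\mathbb{R}$ is quasiperiodic if it is a sum of finitely many continuous periodic functions. For $f:\mathbb{N}\to\mathbb{R}$, a formal series $\sum_{r\ge0}c_r(n)/n^r$ is an a.p.p.s. (asymptotic pseudo-power series) expansion of $f(n)$ in powers of $1/n$, written $f(n)\overset{*}{\sim}\sum_{r\ge0}c_r(n)/n^r$, if each $c_r$ is the restriction to the nonnegative integers of a quasiperiodic function, and for every positive integer $k$ there is a constant $C_{f,k}$ with $\bigl|f(n)-\sum_{r=0}^{k-1}c_r(n)/n^r\bigr|\le C_{f,k}\,n^{-k}$ for all positive integers $n$. *)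

(* Defs.v *)
(* The real numbers are an arbitrary MathComp-Analysis [realType]. *)
From mathcomp Require Import all_boot all_order all_algebra.
From mathcomp Require Import all_classical all_reals all_analysis.
Import numFieldNormedType.Exports.

Set Implicit Arguments.
Unset Strict Implicit.
Unset Printing Implicit Defensive.

Local Open Scope ring_scope.

(* The period must be nonzero: [periodic g 0] holds for every [g]. *)
Definition continuous_periodic (R : realType) (g : R -> R) : Prop :=
  continuous g /\ exists2 T : R, 0 < T & periodic g T.

Definition quasiperiodic (R : realType) (w : R -> R) : Prop :=
  exists (m : nat) (g : 'I_m -> R -> R),
    (forall i, continuous_periodic (g i)) /\
    (forall x, w x = \sum_(i < m) g i x).

(* [c r n] is the coefficient c_r(n). The function f is defined on the positive
   integers: it is encoded on [nat], and its value at 0 is never used. The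
   coefficients, in contrast, are functions on all of [nat], 0 included. *)
Definition apps_expansion (R : realType) (f : nat -> R) (c : nat -> nat -> R)
    : Prop :=
  (forall r : nat, exists2 w : R -> R,
     quasiperiodic w & forall n : nat, c r n = w n%:R) /\
  (forall k : nat, (0 < k)%N -> exists C : R, forall n : nat, (0 < n)%N ->
     `|f n - \sum_(r < k) c r n / n%:R ^+ r| <= C * n%:R ^- k).

(* Main.v *)
Require Import Defs.
From mathcomp Require Import all_boot all_order all_algebra.
From mathcomp Require Import all_classical all_reals all_analysis.
From mathcomp Require Import ring lra.
Import Order.TTheory GRing.Theory Num.Theory numFieldNormedType.Exports.

Set Implicit Arguments.
Unset Strict Implicit.
Unset Printing Implicit Defensive.

Local Open Scope ring_scope.
Local Open Scope classical_set_scope.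

(** Subtracting the two expansions and arguing by strong induction on [r], the
    first coefficient at which they could differ satisfies
    [c r n - c' r n = O(1/n)], hence tends to 0 along the integers.  This
    difference is again quasiperiodic, and a quasiperiodic function cannot tend
    to 0 along the integers without vanishing on them, because its values recur:
    [w (x + q)] is arbitrarily close to [w x] for arbitrarily large integers
    [q] ([quasiperiodic_recurrence]).

    Recurrence is simultaneous Diophantine approximation
    ([simultaneous_approximation]): if [w] is the sum of the [g i], of periods
    [T i], some large integer [q] has all the ratios [q / T i] close to integers,
    so that modulo each period the shift by [q] is a small one, and continuity of
    each [g i] at the single point [x] is enough. *)

(** Dirichlet's pigeonhole: cut the unit cube into [N.+1 ^ m] equal cells.  Among
    the multiples [0, L, 2L, ...] of [L] two have fractional parts of their products
    with [alpha] in the same cell, and their difference is at least [L]. *)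
Lemma simultaneous_approximation (R : realType) (m : nat) (alpha : 'I_m -> R)
    (N L : nat) :
  exists2 q : nat, (L <= q)%N &
    exists p : 'I_m -> int,
      forall i, `|q%:R * alpha i - (p i)%:~R| < N.+1%:R^-1.
Proof.
pose frac (x : R) := x - (Num.floor x)%:~R.
have frac_itv x : 0 <= frac x < 1.
  by have := floor_itv x; rewrite intrD /frac => /andP[? ?]; apply/andP; split; lra.
pose cell x : 'I_N.+1 := inord (Num.truncn (N.+1%:R * frac x)).
have cellE x : (cell x)%:R <= N.+1%:R * frac x < (cell x)%:R + 1.
  have /andP[f0 f1] := frac_itv x.
  have y0 : 0 <= N.+1%:R * frac x by rewrite mulr_ge0.
  rewrite /cell inordK; first by rewrite natr1 truncn_itv.
  by rewrite -(ltr_nat R) (le_lt_trans (y := N.+1%:R * frac x)) ?truncn_le // gtr_pMr ?ltr0n.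
pose F (a : 'I_(#|{ffun 'I_m -> 'I_N.+1}|.+1)) : {ffun 'I_m -> 'I_N.+1} :=
  [ffun i => cell ((a * L)%:R * alpha i)].
have /injectivePn[a [b neq_ab FabE]] : ~~ injectiveb F.
  by apply/injectiveP => /leq_card; rewrite card_ord ltnn.
wlog lt_ab : a b neq_ab FabE / (a < b)%N.
  move=> IH; have := neq_ab; rewrite -val_eqE neq_ltn => /orP[/IH|/IH]; apply=> //.
  by rewrite eq_sym.
exists ((b - a) * L)%N; first by rewrite leq_pmull // subn_gt0.
exists (fun i => Num.floor ((b * L)%:R * alpha i) -
                 Num.floor ((a * L)%:R * alpha i)) => i.
have /(congr1 (fun f : {ffun 'I_m -> 'I_N.+1} => f i)) := FabE.
rewrite !ffunE => cellab.
have := cellE ((a * L)%:R * alpha i); have := cellE ((b * L)%:R * alpha i).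
rewrite cellab => /andP[b1 b2] /andP[a1 a2].
rewrite mulnBl natrB ?leq_mul2r ?(ltnW lt_ab) ?orbT // intrB.
rewrite (_ : _ - _ = frac ((b * L)%:R * alpha i) - frac ((a * L)%:R * alpha i));
  last by rewrite /frac; ring.
rewrite -(ltr_pM2l (ltr0Sn R N)) divff ?pnatr_eq0 //.
rewrite -[X in X * _](ger0_norm (ler0n R N.+1)) -normrM mulrBr ltr_norml.
by apply/andP; split; lra.
Qed.

Lemma periodic_int (R : realType) (g : R -> R) (T : R) (p : int) (x : R) :
  periodic g T -> g (x + T *~ p) = g x.
Proof.
move=> gT; case: p => n; first exact: periodicn gT n x.
by rewrite NegzE mulrNz -[in RHS](subrK (T *+ n.+1) x) (periodicn gT).
Qed.

Lemma quasiperiodicB (R : realType) (v w : R -> R) :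
  quasiperiodic v -> quasiperiodic w -> quasiperiodic (fun x => v x - w x).
Proof.
move=> [m [g [gP vE]]] [m' [h [hP wE]]].
exists (m + m')%N, (fun i x => match fintype.split i with
                               | inl j => g j x | inr j => - h j x end).
split=> [i|x].
  case: (fintype.split i) => j; first exact: gP.
  have [hc [T T0 hT]] := hP j; split; first by move=> x; apply: cvgN; exact: hc.
  by exists T => // x; rewrite hT.
rewrite vE wE big_split_ord -sumrN /=.
by congr (_ + _); apply: eq_bigr => j _;
  rewrite ?(unsplitK (inl j)) ?(unsplitK (inr j)).
Qed.

Lemma quasiperiodic_recurrence (R : realType) (w : R -> R) (x e : R) (L : nat) :
  quasiperiodic w -> 0 < e ->
  exists2 q : nat, (L <= q)%N & `|w (x + q%:R) - w x| < e.
Proof.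
move=> [m [g [gP wE]]] e0.
have [T TP] : {T : 'I_m -> R & forall i, 0 < T i /\ periodic (g i) (T i)}.
  by apply: (@choice _ _ (fun i t => 0 < t /\ periodic (g i) t)) => i;
    have [_ [t t0 gt]] := gP i; exists t.
have e'0 : 0 < e / m.+1%:R by rewrite divr_gt0.
have near_g i : \forall u \near (0 : R),
    `|g i x - g i (x + u * T i)| < e / m.+1%:R.
  have [gc _] := gP i.
  have : g i (x + u * T i) @[u --> (0 : R)] --> g i (x + 0 * T i).
    apply: (@continuous_comp _ _ _ (fun u : R => x + u * T i) (g i));
      last exact: gc.
    by apply: cvgD; [exact: cvg_cst|apply: cvgM; [exact: cvg_id|exact: cvg_cst]].
  by rewrite mul0r addr0 => /cvgrPdist_lt; exact.
have /nbhs_ballP[d /= d0 dP] : \forall u \near (0 : R),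
    forall i, `|g i x - g i (x + u * T i)| < e / m.+1%:R.
  exact: filter_forall near_g.
have [N] := ltr_add_invr d0; rewrite add0r => Nd.
have [q Lq [p pP]] := simultaneous_approximation (fun i => (T i)^-1) N L.
exists q => //; rewrite !wE -sumrB.
apply: (@le_lt_trans _ _ (\sum_(i < m) e / m.+1%:R)).
  apply: le_trans (ler_norm_sum _ _ _) _; apply: ler_sum => i _.
  have [Ti0 Tip] := TP i.
  rewrite distrC.
  (* modulo the period, the shift by [q] is the small shift [(q / T i - p i) * T i] *)
  have -> : x + q%:R = x + (q%:R * (T i)^-1 - (p i)%:~R) * T i + T i *~ p i.
    by rewrite -[T i *~ _]mulrzl mulrBl mulfVK ?gt_eqF // -addrA subrK.
  rewrite periodic_int //; apply/ltW/dP.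
  by rewrite /ball /= distrC subr0 (lt_trans (pP i)).
rewrite sumr_const card_ord -[X in X < _]mulr_natl mulrCA gtr_pMr // ltr_pdivrMr //.
by rewrite mul1r ltr_nat.
Qed.

Lemma quasiperiodic_eq0 (R : realType) (w : R -> R) :
  quasiperiodic w -> w n%:R @[n --> \oo] --> (0 : R) ->
  forall n : nat, w n%:R = 0.
Proof.
move=> wq /cvgr0Pnorm_lt w0 n; apply/eqP; rewrite -normr_le0.
apply/ler_addgt0Pr => e e0; rewrite add0r.
have e2 : 0 < e / 2 by rewrite divr_gt0.
have [L _ LP] := w0 _ e2.
have [q Lq qP] := quasiperiodic_recurrence n%:R L wq e2.
have /LP : (L <= n + q)%N by rewrite (leq_trans Lq) // leq_addl.
rewrite /= natrD => wnq.
have := ler_distD (w (n%:R + q%:R)) (w n%:R) 0.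
rewrite !subr0 => /le_trans; apply; rewrite distrC; lra.
Qed.

(** The defining estimates with [k = r.+1] for both expansions bound the
    difference of the two partial sums, in which only the last term survives. *)
Lemma first_difference_bound (R : realType) (f : nat -> R)
    (c c' : nat -> nat -> R) (r : nat) :
  apps_expansion f c -> apps_expansion f c' ->
  (forall j, (j < r)%N -> c j = c' j) ->
  exists C : R, forall n, `|c r n.+1 - c' r n.+1| <= C * n.+1%:R^-1.
Proof.
move=> [_ /(_ r.+1 isT)[C CP]] [_ /(_ r.+1 isT)[C' CP']] eq_cc'.
exists (C + C') => n; set N : R := n.+1%:R.
have N0 : 0 < N by rewrite ltr0n.
have := lerD (CP' _ (ltn0Sn n)) (CP _ (ltn0Sn n)).
rewrite [X in _ + X]distrC => /(le_trans (ler_normD _ _)).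
rewrite !big_ord_recr /= -/N.
have -> : \sum_(i < r) c i n.+1 / N ^+ i = \sum_(i < r) c' i n.+1 / N ^+ i.
  by apply: eq_bigr => i _; rewrite eq_cc'.
rewrite (_ : _ + _ = (c r n.+1 - c' r n.+1) * N ^- r); last by ring.
have Nr0 : 0 < N ^- r by rewrite invr_gt0 exprn_gt0.
rewrite normrM (gtr0_norm Nr0).
rewrite ler_pdivrMr ?exprn_gt0 // => /le_trans; apply.
rewrite exprS invfM -mulrDl [C' + C]addrC -!mulrA mulVf ?mulr1 //.
by rewrite expf_neq0 // gt_eqF.
Qed.

Theorem proposition2 (R : realType) (f : nat -> R) (c c' : nat -> nat -> R)
    (hc : apps_expansion f c) (hc' : apps_expansion f c') :
  forall r : nat, c r = c' r.
Proof.
elim/ltn_ind => r IH.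
have [v vq cE] := hc.1 r; have [w wq c'E] := hc'.1 r.
have [C CP] := first_difference_bound hc hc' IH.
apply/funext => n; apply/eqP; rewrite -subr_eq0 cE c'E; apply/eqP.
apply: (quasiperiodic_eq0 (quasiperiodicB vq wq)).
rewrite -(cvg_shiftS (fun n => v n%:R - w n%:R)); apply/norm_cvg0P.
apply: (@squeeze_cvgr _ _ _ _ (fun=> 0) (fun n => C * n.+1%:R^-1)).
- by near=> k; rewrite normr_ge0 /= -cE -c'E CP.
- exact: cvg_cst.
- by rewrite -[X in _ --> X](mulr0 C); apply: cvgM (cvg_cst _) cvg_harmonic.
Unshelve. all: by end_near. Qed.
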